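(* Let $n\in\mathbb{N}$, let $B=(\{0,1\}^n,\le)$, let $L_D$ be the free distributive lattice with $n$ generators $w_1,\ldots,w_n$ (with bottom and top included, as described in the context), and let $\overline{\beta}:B\to L_D$ be defined by $\overline{\beta}(x)=\bigvee_{i=1}^n (w_i\cdot x_i)$ for $x=(x_1,\ldots,x_n)\in B$. Then $\overline{\beta}$ is an $L_D$-valued up-set on $B$. Moreover, for every complete lattice $L$ and every $L$-valued up-set $\mu:B\to L$ on $B$, the collection of cuts $\{\mu_p\mid p\in L\}$ of $\mu$ is contained in the collection of cuts $\{\overline{\beta}_t\mid t\in L_D\}$ of $\overline{\beta}$.
   Context: $B=\{0,1\}^n$ is ordered componentwise with respect to $0\le 1$. The free distributive lattice $L_D$ with $n$ generators $w_1,\ldots,w_n$ is taken with the join and the meet of the empty set of generators also counted, as the bottom $0$ and the top $1$ of $L_D$ respectively (i.e., it is the free bounded distributive lattice on $w_1,\ldots,w_n$; it is finite, hence complete). For $w\in L_D$ and $x\in\{0,1\}$, $w\cdot x\in L_D$ is defined by $w\cdot 1=w$ and $w\cdot 0=0$ (the bottom of $L_D$). For a complete lattice $L$, an $L$-valued up-set on $B$ is a function $\mu:B\to L$ such that $x\le y$ implies $\mu(x)\le\mu(y)$ for all $x,y\in B$. For $p\in L$, the cut ($p$-cut) of $\mu:B\to L$ is $\mu_p=\{x\in B\mid \mu(x)\ge p\}$. *)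

(* Defs.v *)
From mathcomp Require Import all_boot all_order.
From mathcomp Require Import classical_sets.

Set Implicit Arguments.
Unset Strict Implicit.
Unset Printing Implicit Defensive.

Import Order.TTheory.

Local Open Scope classical_set_scope.
Local Open Scope order_scope.

Definition complete_lattice (d : Order.disp_t) (L : porderType d) : Prop :=
  forall A : set L, supremums A !=set0 /\ infimums A !=set0.

(* MathComp's {tblmorphism L -> M} only requires \bot and \top to be
   preserved, not `&` and `|`, hence this predicate. *)
Definition bounded_lattice_morphism (d d' : Order.disp_t)
    (L : tbDistrLatticeType d) (M : tbDistrLatticeType d') (h : L -> M) : Prop :=
  [/\ Order.meet_morphism h, Order.join_morphism h, h \bot = \bot
    & h \top = \top].

(* L is the free bounded distributive lattice on the family w, expressed by its
   universal property.  MathComp does not require \bot != \top, so M also ranges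
   over the one-element lattice. *)
Definition free_bounded_distr_lattice (d : Order.disp_t)
    (L : tbDistrLatticeType d) (n : nat) (w : 'I_n -> L) : Prop :=
  forall (d' : Order.disp_t) (M : tbDistrLatticeType d') (f : 'I_n -> M),
    exists h : L -> M,
      [/\ bounded_lattice_morphism h,
          forall i, h (w i) = f i
        & forall g : L -> M, bounded_lattice_morphism g ->
            (forall i, g (w i) = f i) -> g =1 h].

(* n.-tupleprod is the type of n-tuples with the componentwise order; the order
   of bool is false < true. *)
Definition cube (n : nat) := n.-tupleprod bool.

Definition valued_upset (n : nat) (d : Order.disp_t) (L : porderType d)
    (mu : cube n -> L) : Prop :=
  complete_lattice L /\ forall x y : cube n, x <= y -> mu x <= mu y.

Definition cut (n : nat) (d : Order.disp_t) (L : porderType d)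
    (mu : cube n -> L) (p : L) : set (cube n) :=
  [set x | p <= mu x].

Definition cuts (n : nat) (d : Order.disp_t) (L : porderType d)
    (mu : cube n -> L) : set (set (cube n)) :=
  [set cut mu p | p in [set: L]].

Definition scale (d : Order.disp_t) (L : tbDistrLatticeType d)
    (w : L) (x : bool) : L :=
  if x then w else \bot.

Definition beta_bar (n : nat) (d : Order.disp_t) (L : tbDistrLatticeType d)
    (w : 'I_n -> L) (x : cube n) : L :=
  \join_(i < n) scale (w i) (tnth x i).

(* Main.v *)
Require Import Defs.
From HB Require Import structures.
From mathcomp Require Import all_boot all_order.
From mathcomp Require Import boolp classical_sets.

(** Monotonicity of [beta_bar w] follows from its turning joins in the cube into
joins in the lattice. The two remaining points are the completeness of the free
lattice [L] and the realization of every cut of every up-set.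

Completeness. [L] is given by a universal property only, so its finiteness must
be extracted from it. The sublattice generated by the [w i] is again a
distributive lattice; the universal property retracts [L] onto it, and by
uniqueness the retraction is the identity: this is the induction principle
[free_bounded_distr_lattice_ind]. By distributivity, the meets of values of
[beta_bar w] are closed under both lattice operations, and they contain the
bounds and the generators, so they exhaust [L] ([free_meet_beta_bar]; this is
the conjunctive normal form). The cube being finite, there are finitely many
such meets, and a finite bounded lattice is complete.

Cuts. Let [U] be the cut of [mu] at [p], an up-set of the cube, and let [t] be
the meet of the [beta_bar w y] for [y] in [U]. Every [x] in [U] satisfies
[t <= beta_bar w x]. Conversely, [t <= beta_bar w x] forces some [y] in [U] to
lie below [x] ([meet_beta_bar_le]), whence [x] is in [U]. This is where freeness
matters: the assignment [w i |-> ~~ x_i] extends to a morphism from [L] to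
[bool], and this morphism sends [beta_bar w x] to [false], but [beta_bar w y] to
[true] for each [y] that is not below [x]. Hence the cut of [beta_bar w] at [t]
is [U]. *)

Set Implicit Arguments.
Unset Strict Implicit.
Unset Printing Implicit Defensive.

Import Order.TTheory.

Local Open Scope order_scope.

(** The elements satisfying [P] form a sublattice [M] of [L] that contains the
generators, so there is a morphism from [L] to [M] fixing them. Followed by the
inclusion of [M] in [L], it is an endomorphism of [L] fixing the generators,
hence the identity, so every element of [L] lies in [M]. *)
Lemma free_bounded_distr_lattice_ind (d : Order.disp_t)
    (L : tbDistrLatticeType d) (n : nat) (w : 'I_n -> L) (P : L -> Prop) :
  free_bounded_distr_lattice w ->
  (forall i, P (w i)) -> P \bot -> P \top ->
  (forall a b, P a -> P b -> P (a `&` b)) ->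
  (forall a b, P a -> P b -> P (a `|` b)) ->
  forall a, P a.
Proof.
move=> free Pw P0 P1 PI PU.
pose S : pred L := fun a => `[< P a >].
have SI : {in S &, forall a b, a `&` b \in S}.
  by move=> a b /asboolP Pa /asboolP Pb; apply/asboolP/PI.
have SU : {in S &, forall a b, a `|` b \in S}.
  by move=> a b /asboolP Pa /asboolP Pb; apply/asboolP/PU.
have S0 : \bot \in S by apply/asboolP.
have S1 : \top \in S by apply/asboolP.
pose U := {a : L | S a}.
pose sub := Order.SubChoice_isTBSubLattice.Build d L S d U SI SU S0 S1.
pose K : Order.TBSubLattice.type S d := HB.pack U sub.
have valI := @Order.valI_subproof _ _ _ _ K.
have valU := @Order.valU_subproof _ _ _ _ K.
have val0 := @Order.val0_subproof _ _ _ _ K.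
have val1 := @Order.val1_subproof _ _ _ _ K.
have distr : left_distributive (@Order.meet d K) (@Order.join d K).
  by move=> x y z; apply: val_inj; rewrite valI !valU !valI meetUl.
pose dist := Order.Lattice_Meet_isDistrLattice.Build d K distr.
pose M : tbDistrLatticeType d := HB.pack U sub dist.
have Sw i : S (w i) by apply/asboolP.
have [h [[hI hU h0 h1] hw _]] := free d M (fun i => exist _ (w i) (Sw i)).
have [g [_ _ g_uniq]] := free d L w.
have val_h a : val (h a : U) = a.
  transitivity (g a); last by symmetry; apply: (g_uniq id).
  apply: (g_uniq (fun a => val (h a : K))).
    by split=> [x y|x y||]; rewrite ?(hI, hU, h0, h1, valI, valU, val0, val1).
  by move=> i; rewrite hw.
by move=> a; rewrite -(val_h a); apply/asboolP; apply: valP (h a : U).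
Qed.

(** An arbitrary join or meet is a finite one, taken over the indices in [T] of
the elements of the subset. *)
Lemma finite_complete_lattice (d : Order.disp_t) (L : tbLatticeType d)
    (T : finType) (F : T -> L) :
  (forall a, exists t, a = F t) -> complete_lattice L.
Proof.
move=> F_surj A; split.
- exists (\join_(t | `[< A (F t) >]) F t); split.
  + move=> a Aa; have [t def_a] := F_surj a; rewrite def_a.
    by apply: joins_sup; apply/asboolP; rewrite -def_a.
  + by move=> b ub_b; apply/joinsP => t /asboolP; apply: ub_b.
- exists (\meet_(t | `[< A (F t) >]) F t); split.
  + move=> a Aa; have [t def_a] := F_surj a; rewrite def_a.
    by apply: meets_inf; apply/asboolP; rewrite -def_a.
  + by move=> b lb_b; apply/meetsP => t /asboolP; apply: lb_b.
Qed.

(* On a bounded distributive lattice, join distributes over finite meets; this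
   instance makes [big_distrl] and [big_distrr] available for them. *)
HB.instance Definition _ (d : Order.disp_t) (L : tbDistrLatticeType d) :=
  Monoid.isAddLaw.Build L Order.join Order.meet joinIl joinIr.

Section BetaBar.

Variables (n : nat) (d : Order.disp_t) (L : tbDistrLatticeType d).
Implicit Types (w : 'I_n -> L) (x y : cube n).

Lemma beta_barU w : {morph beta_bar w : x y / x `|` y}.
Proof.
move=> x y; rewrite /beta_bar -big_split; apply: eq_bigr => i _ /=.
rewrite tnth_join.
by case: (tnth x i) (tnth y i) => [] []; rewrite /= ?joinxx ?joinx0 ?join0x.
Qed.

Lemma le_beta_bar w : {homo beta_bar w : x y / x <= y}.
Proof. by move=> x y; rewrite !leEjoin -beta_barU => /eqP->. Qed.

Lemma beta_bar_zero w : beta_bar w [tuple false | i < n] = \bot.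
Proof. by rewrite /beta_bar big1 // => i _; rewrite tnth_mktuple. Qed.

Lemma beta_bar_unit w i : beta_bar w [tuple j == i | j < n] = w i.
Proof.
rewrite /beta_bar (bigD1 i) //= tnth_mktuple eqxx big1 ?joinx0 // => j ne_ji.
by rewrite tnth_mktuple (negPf ne_ji).
Qed.

Lemma morph_beta_bar d' (M : tbDistrLatticeType d') (h : L -> M) w x :
  bounded_lattice_morphism h -> h (beta_bar w x) = beta_bar (h \o w) x.
Proof.
move=> [_ hU h0 _]; rewrite /beta_bar (big_morph h hU h0).
by apply: eq_bigr => i _; rewrite /scale; case: ifP.
Qed.

(** Conjunctive normal form: each [beta_bar w x] is a clause, a join of
generators. A join of two meets of clauses is, by distributivity, the meet of
the pairwise joins of clauses, which are clauses by [beta_barU]. *)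
Lemma free_meet_beta_bar w (a : L) :
  free_bounded_distr_lattice w ->
  exists s : seq (cube n), a = \meet_(x <- s) beta_bar w x.
Proof.
move=> free; move: a; apply: (free_bounded_distr_lattice_ind free).
- by move=> i; exists [:: [tuple j == i | j < n]]; rewrite big_seq1 beta_bar_unit.
- by exists [:: [tuple false | i < n]]; rewrite big_seq1 beta_bar_zero.
- by exists [::]; rewrite big_nil.
- by move=> _ _ [s ->] [t ->]; exists (s ++ t); rewrite big_cat.
- move=> _ _ [s ->] [t ->].
  exists [seq x `|` y | x <- s, y <- t].
  rewrite big_allpairs_dep big_distrl /=; apply: eq_bigr => x _.
  by rewrite big_distrr /=; apply: eq_bigr => y _; rewrite beta_barU.
Qed.

Lemma free_complete_lattice w :
  free_bounded_distr_lattice w -> complete_lattice L.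
Proof.
move=> free.
pose F (U : {set cube n}) := \meet_(x in U) beta_bar w x.
apply: (finite_complete_lattice (F := F)) => a.
have [s ->] := free_meet_beta_bar a free; exists [set x in s].
by rewrite meets_seq; apply: eq_bigl => x; rewrite inE.
Qed.

End BetaBar.

Lemma beta_bar_boolE (n : nat) (v : 'I_n -> bool) (x : cube n) :
  beta_bar v x = [exists i, v i && tnth x i].
Proof.
apply/idP/existsP => [|[i]].
- apply: contraTP => no_i; rewrite /beta_bar big1 // => i _.
  rewrite /scale; case: ifP => // xi; apply/negP => vi.
  by apply: no_i; exists i; rewrite vi.
- by move=> /andP[vi xi]; rewrite /beta_bar (bigD1 i) //= /scale xi vi.
Qed.

(** In the free lattice a meet of clauses lies below a clause only if one of them
already does so for the evident reason that its variables are among those of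
the latter. Otherwise, the truth assignment making false exactly the variables
in [x] satisfies all the clauses of the meet and falsifies [beta_bar w x]. *)
Lemma meet_beta_bar_le (n : nat) (d : Order.disp_t) (L : tbDistrLatticeType d)
    (w : 'I_n -> L) (U : pred (cube n)) (x : cube n) :
  free_bounded_distr_lattice w ->
  \meet_(y | U y) beta_bar w y <= beta_bar w x -> exists2 y, U y & y <= x.
Proof.
move=> free; apply: contraPP => noU.
have [h [h_mor hw _]] := free _ bool (fun i => ~~ tnth x i).
have hE y : h (beta_bar w y) = [exists i, ~~ tnth x i && tnth y i].
  by rewrite morph_beta_bar // -beta_bar_boolE; apply: eq_bigr => i _; rewrite /= hw.
have [hI _ _ h1] := h_mor.
move=> /meet_idPl /(congr1 h); rewrite hI (big_morph h hI h1) hE.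
have -> : [exists i, ~~ tnth x i && tnth x i] = \bot.
  by apply/existsP => -[i]; rewrite andNb.
rewrite meetx0 big1 // => y Uy; rewrite hE; apply/existsP.
apply: contra_notP noU => no_i; exists y => //.
rewrite leEtprod; apply/forallP => i; apply: contra_notT no_i => nle_i.
by exists i; case: (tnth x i) (tnth y i) nle_i => [] [].
Qed.

Theorem corollary4p2 (n : nat) (d : Order.disp_t) (LD : tbDistrLatticeType d)
    (w : 'I_n -> LD) (LD_free : free_bounded_distr_lattice w) :
  valued_upset (beta_bar w) /\
  forall (d' : Order.disp_t) (L : porderType d') (mu : cube n -> L),
    valued_upset mu -> (cuts mu `<=` cuts (beta_bar w))%classic.
Proof.
split.
  by split; [apply: free_complete_lattice LD_free | apply: le_beta_bar].
move=> d' L mu [_ mu_le] _ [p _ <-].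
exists (\meet_(x | p <= mu x) beta_bar w x) => //.
apply/seteqP; split=> [x|x px] /=.
- by move=> /(meet_beta_bar_le LD_free)[y py /mu_le]; apply: le_trans.
- exact: meets_inf.
Qed.
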